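(* Let $X$ be a non-empty set and let $(A,s),(B,t)\in M(X^*,X\cup\overline{X^*})$. Then $(A,s)\mathrel{\rho}(B,t)$ if and only if $s=t$ and $A^{\wedge}=B^{\wedge}$.
   Context: A restriction semigroup is an algebra $(R;\cdot,{}^+)$ of type $(2,1)$ such that $(R;\cdot)$ is a semigroup and the identities $x^+x=x$, $x^+y^+=y^+x^+$, $(x^+y)^+=x^+y^+$, $xy^+=(xy)^+x$ hold. Its set of projections is $P(R)=\{s^+ : s\in R\}$. The natural partial order is $s\le t$ iff $s=et$ for some $e\in P(R)$. The congruence $\sigma$ is given by $s\mathrel{\sigma}t$ iff $es=et$ for some $e\in P(R)$. An $F$-restriction semigroup is a restriction semigroup in which every $\sigma$-class has a maximum element with respect to $\le$; the maximum element of the $\sigma$-class of $s$ is denoted $s^{\mathfrak{m}}$. It has a maximum projection, denoted $\lambda$, which is its unique left identity. $F$-restriction semigroups, regarded as algebras in the signature $(\cdot,{}^+,{}^{\mathfrak{m}},\lambda)$ of type $(2,1,1,0)$, form a variety, and $\mathsf{FFR}(X)$ denotes its free $X$-generated object. $X^*$ is the free monoid on $X$ with identity $\lambda$, and $\overline{X^*}=\{\overline{u}:u\in X^*\}$ is a disjoint bijective copy of $X^*$. The Cayley graph $\mathrm{Cay}(X^*,X\cup\overline{X^*})$ has vertex set $X^*$ and labeled directed edges $(w,x,wx)$ and $(w,\overline{u},wu)$ for $w\in X^*$, $x\in X$, $u\in X^*$. A subgraph is accessible if it contains the vertex $\lambda$ and each of its vertices is reachable by a directed path in the subgraph from $\lambda$.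 $M(X^*,X\cup\overline{X^*})$ is the restriction semigroup of all pairs $(\Gamma,s)$ where $\Gamma$ is a finite accessible subgraph of this Cayley graph with at least one edge and $s$ is a vertex of $\Gamma$, with $(A,s)(B,t)=(A\cup sB,st)$ and $(A,s)^+=(A,\lambda)$, where $sB$ is the left translate of $B$ by $s$. It is generated as a restriction semigroup by the elements $x=(\Gamma_x,x)$ ($x\in X$) and $\overline{u}=(\Gamma_{\overline{u}},u)$ ($u\in X^*$), where $\Gamma_y$ consists of the single edge labeled $y$ starting at $\lambda$ and its endpoints. There is a unique surjective $(\cdot,{}^+)$-morphism $M(X^*,X\cup\overline{X^*})\to\mathsf{FFR}(X)$ with $x\mapsto x$ and $\overline{u}\mapsto u^{\mathfrak{m}}$ ($u$ evaluated in $\mathsf{FFR}(X)$, with the empty word giving $\lambda$); $\rho$ denotes its kernel congruence. Equivalently, $\rho$ is the $(\cdot,{}^+)$-congruence generated by the pairs $(\overline{u},\overline{\lambda}\,\overline{u})$ for $u\in X^+$, $(x,x^+\overline{x})$ for $x\in X$, and $(\overline{u}\,\overline{v},(\overline{u}\,\overline{v})^+\overline{uv})$ for $u,v\in X^+$, where $X^+$ is the free semigroup on $X$. For a finite accessible subgraph $\Gamma$ with at least one edge, consider the transformations: ($T_1$) if $\Gamma$ has an edge $(v,\overline{u},vu)$ but not the edge $(v,\overline{\lambda},v)$, add the edge $(v,\overline{\lambda},v)$; ($T_2$) if $\Gamma$ has an edge $(v,x,vx)$ with $x\in X$ but not the edge $(v,\overline{x},vx)$, add the edge $(v,\overline{x},vx)$;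 ($T_3$) if $\Gamma$ has edges $(w,\overline{u},wu)$ and $(wu,\overline{v},wuv)$ but not the edge $(w,\overline{uv},wuv)$, add the edge $(w,\overline{uv},wuv)$. $\Gamma^{\wedge}$ denotes the finite graph obtained from $\Gamma$ by applying these transformations until none of them is applicable (the process terminates and the result does not depend on the choices). *)

(* Defs.v *)
From Stdlib Require Import Relation_Operators Operators_Properties.
From Stdlib Require List.
From mathcomp Require Import all_boot.
From mathcomp Require Import boolp classical_sets functions cardinality.

Set Implicit Arguments.
Unset Strict Implicit.
Unset Printing Implicit Defensive.

Local Open Scope classical_set_scope.

Declare Scope restr_scope.
Delimit Scope restr_scope with restr.

Record restrSemigroup := RestrSemigroup {
  rcar :> Type;
  rmul : rcar -> rcar -> rcar;
  rplus : rcar -> rcar;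
  rmulA : forall x y z, rmul x (rmul y z) = rmul (rmul x y) z;
  rplusK : forall x, rmul (rplus x) x = x;
  rplusC : forall x y,
    rmul (rplus x) (rplus y) = rmul (rplus y) (rplus x);
  rplusM : forall x y,
    rplus (rmul (rplus x) y) = rmul (rplus x) (rplus y);
  rplusJ : forall x y, rmul x (rplus y) = rmul (rplus (rmul x y)) x
}.

Notation "x * y" := (rmul x y) : restr_scope.
Notation "x ^#" := (rplus x) (at level 2, format "x ^#") : restr_scope.

Local Open Scope restr_scope.

Section Relations.
Variable R : restrSemigroup.

Definition is_proj (e : R) : Prop := exists s : R, e = s^#.

Definition nle (s t : R) : Prop := exists2 e : R, is_proj e & s = e * t.

Definition sigma (s t : R) : Prop := exists2 e : R, is_proj e & e * s = e * t.

Definition is_class_max (s m : R) : Prop :=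
  sigma s m /\ forall t, sigma s t -> nle t m.

Definition is_max_proj (l : R) : Prop :=
  is_proj l /\ forall e, is_proj e -> nle e l.

End Relations.

(* F-restriction semigroups as algebras of type (2,1,1,0). The order is
   antisymmetric, so fmax and flam are determined by the underlying
   restriction semigroup; that flam is the unique left identity is proved
   below (flamL, flam_unique). *)
Record fRestr := FRestr {
  fbase :> restrSemigroup;
  fmax : fbase -> fbase;
  flam : fbase;
  fmaxP : forall s, is_class_max s (fmax s);
  flamP : is_max_proj flam
}.

Definition is_rmorph (R S : restrSemigroup) (h : R -> S) : Prop :=
  (forall x y, h (x * y) = h x * h y) /\ (forall x, h x^# = (h x)^#).

Definition is_fmorph (R S : fRestr) (h : R -> S) : Prop :=
  [/\ is_rmorph h, forall x, h (fmax x) = fmax (h x) & h (flam R) = flam S].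

Definition is_free (X : Type) (F : fRestr) (i : X -> F) : Prop :=
  forall (R : fRestr) (f : X -> R),
    exists! h : F -> R, is_fmorph h /\ forall x, h (i x) = f x.

(* The value of a word; the empty word has value flam. In general flam is only
   a left identity, so a nonempty word must not be multiplied by it on the
   right. *)
Definition word_val (X : Type) (R : fRestr) (f : X -> R) (u : seq X) : R :=
  if u is x :: v then foldl (fun a y => a * f y) (f x) v else flam R.

Section BasicTheory.
Variable R : restrSemigroup.
Implicit Types x y z s t e f : R.

Lemma rpp x : x^# * x^# = x^#.
Proof. by rewrite -rplusM rplusK. Qed.

Lemma rplus_id x : x^#^# = x^#.
Proof. by rewrite -{1}(rpp x) rplusM rplusC rplusK. Qed.

Lemma projE e : is_proj e -> e^# = e.
Proof. by case=> s ->; rewrite rplus_id. Qed.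

Lemma proj_plus x : is_proj x^#. Proof. by exists x. Qed.

Lemma projC e f : is_proj e -> is_proj f -> e * f = f * e.
Proof. by move=> [x ->] [y ->]; rewrite rplusC. Qed.

Lemma projI e : is_proj e -> e * e = e.
Proof. by move=> [x ->]; rewrite rpp. Qed.

Lemma projM e f : is_proj e -> is_proj f -> is_proj (e * f).
Proof. by move=> [x ->] [y ->]; exists (x^# * y); rewrite rplusM. Qed.

Lemma projMl e x : is_proj e -> (e * x)^# = e * x^#.
Proof. by move=> [s ->]; rewrite rplusM. Qed.

Lemma rplusMl x y : x^# * (x * y)^# = (x * y)^#.
Proof. by rewrite -rplusM rmulA rplusK. Qed.

Lemma rplusMr x y : (x * y^#)^# = (x * y)^#.
Proof. by rewrite rplusJ rplusM rplusC rplusMl. Qed.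

Lemma projJ x e : is_proj e -> x * e = (x * e)^# * x.
Proof. by move=> [s ->]; rewrite rplusMr rplusJ. Qed.

Lemma sigma_refl s : sigma s s.
Proof. by exists s^#; first exact: proj_plus. Qed.

Lemma sigma_sym s t : sigma s t -> sigma t s.
Proof. by case=> e pe h; exists e. Qed.

Lemma sigma_trans s t x : sigma s t -> sigma t x -> sigma s x.
Proof.
move=> [e pe h] [f pf k]; exists (e * f); first exact: projM.
by rewrite -(rmulA _ _ x) -k rmulA (projC pe pf) -!rmulA h.
Qed.

Lemma sigma_mulr s t x : sigma s t -> sigma (s * x) (t * x).
Proof. by move=> [e pe h]; exists e => //; rewrite !rmulA h. Qed.

Lemma sigma_mull s t x : sigma s t -> sigma (x * s) (x * t).
Proof.
move=> [e pe h]; exists (x * e)^#; first exact: proj_plus.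
by rewrite !rmulA -(projJ x pe) -!rmulA h.
Qed.

Lemma nle_sigma s t : nle s t -> sigma s t.
Proof. by move=> [e pe ->]; exists e => //; rewrite rmulA projI. Qed.

Lemma nleE s t : nle s t -> s = s^# * t.
Proof. by move=> [e pe ->]; rewrite projMl // -rmulA rplusK. Qed.

Lemma nle_anti s t : nle s t -> nle t s -> s = t.
Proof.
move=> st [f pf ts]; case: (st) => e pe es.
have ft : f * t = t by rewrite ts rmulA projI.
by rewrite {1}es -{1}ft rmulA (projC pe pf) -rmulA -es -ts.
Qed.

Lemma class_max_unique s m m' :
  is_class_max s m -> is_class_max s m' -> m = m'.
Proof. by move=> [sm h] [sm' h']; apply: nle_anti; [apply: h' | apply: h]. Qed.

Definition ple e f := e * f = e.

Lemma ple_trans e f g : ple e f -> ple f g -> ple e g.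
Proof. by rewrite /ple => ef fg; rewrite -ef -rmulA fg. Qed.

Lemma pleM e f g : is_proj e -> is_proj f ->
  ple g (e * f) <-> ple g e /\ ple g f.
Proof.
move=> pe pf; rewrite /ple; split=> [h|[h k]]; last by rewrite rmulA h k.
split; rewrite -{1}h -rmulA; last by rewrite -(rmulA e) (projI pf) h.
by rewrite (projC pe pf) -(rmulA f) (projI pe) -(projC pe pf) h.
Qed.

Lemma ple_anti e f : is_proj e -> is_proj f -> (forall g, is_proj g ->
  (ple g e <-> ple g f)) -> e = f.
Proof.
move=> pe pf h; rewrite -(proj1 (h e pe) (projI pe)) (projC pe pf).
exact: (proj2 (h f pf) (projI pf)).
Qed.

Lemma ple_mull x y e : ple e (x * y)^# -> ple e x^#.
Proof.
move=> h; apply: ple_trans h _.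
by rewrite /ple rplusC rplusMl.
Qed.

Lemma ple_mulr x y z e : nle y z -> ple e (x * y)^# -> ple e (x * z)^#.
Proof.
move=> [f pf ->] h; apply: ple_trans h _.
rewrite rmulA (projJ x pf) -rmulA rplusM /ple.
by rewrite -rmulA rpp.
Qed.

End BasicTheory.

Section FTheory.
Variable R : fRestr.
Implicit Types s t x : R.

Lemma fmax_eq s t : sigma s t -> fmax s = fmax t.
Proof.
move=> st; apply: (class_max_unique (fmaxP s)).
case: (fmaxP t) => h k; split; first exact: sigma_trans st h.
by move=> x sx; apply: k; apply: sigma_trans (sigma_sym st) sx.
Qed.

Lemma nle_fmax s : nle s (fmax s).
Proof. by apply: (fmaxP s).2; apply: sigma_refl. Qed.

Lemma flam_proj : is_proj (flam R). Proof. exact: (flamP R).1. Qed.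

Lemma ple_flam (e : R) : is_proj e -> ple e (flam R).
Proof.
move=> pe; case: ((flamP R).2 e pe) => g pg ->.
by rewrite /ple -rmulA projI //; apply: flam_proj.
Qed.

Lemma flamL x : flam R * x = x.
Proof.
by rewrite -{1}(rplusK x) rmulA (projC flam_proj (proj_plus x))
  (ple_flam (proj_plus x)) rplusK.
Qed.

Lemma flam_unique l : (forall x, l * x = x) -> l = flam R.
Proof.
move=> h; have pl : is_proj l.
  by exists l; rewrite -{1}(h l^#) (projJ l (proj_plus l)) rplusMr h rplusK.
by rewrite -(ple_flam pl) h.
Qed.

Lemma fmax_flam : fmax (flam R) = flam R.
Proof.
set m := fmax _; have pm : is_proj m.
  have : nle m^# m.
    apply: (fmaxP _).2; exists (m^# * flam R).
      exact: projM (proj_plus _) flam_proj.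
    rewrite (ple_flam (proj_plus m)) -[LHS]/(m^# * flam R).
    by rewrite (ple_flam (proj_plus m)) rpp.
  move=> [g pg e]; exists m.
  have gm : g * m^# = m^# by rewrite e rmulA projI.
  by rewrite -{1}(rplusK m) -{1}gm (projC pg (proj_plus m)) -rmulA -e rpp.
apply: nle_anti; last exact: nle_fmax.
exact: (flamP R).2.
Qed.

Lemma sigma_flamr x : sigma (x * flam R) x.
Proof.
apply: nle_sigma; exists (x * flam R)^#; first exact: proj_plus.
exact: projJ flam_proj.
Qed.

Lemma sigma_fmax s : sigma s (fmax s). Proof. by case: (fmaxP s). Qed.

Lemma fmax_mul s t : fmax s * fmax t = (fmax s * fmax t)^# * fmax (s * t).
Proof.
apply: nleE; apply: (fmaxP _).2; apply: (@sigma_trans _ _ (fmax s * t)).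
  by apply: sigma_mulr; apply: sigma_fmax.
by apply: sigma_mull; apply: sigma_fmax.
Qed.

Lemma word_val_cat (X : Type) (f : X -> R) (u v : seq X) :
  sigma (word_val f (u ++ v)) (word_val f u * word_val f v).
Proof.
case: u => [|x u] /=; first by rewrite flamL; apply: sigma_refl.
case: v => [|y v] /=; first by rewrite cats0; apply: sigma_sym; apply: sigma_flamr.
rewrite foldl_cat /=; set a := foldl _ _ u.
suff -> : a * foldl (fun a z => a * f z) (f y) v =
  foldl (fun a z => a * f z) (a * f y) v by apply: sigma_refl.
by elim: v (f y) => //= z v IH b; rewrite IH rmulA.
Qed.

End FTheory.

(* Edges of the Cayley graph: (w, inl x) is the edge (w, x, wx) and
   (w, inr u) is the edge from w to wu labeled by the barred copy of u; the
   terminal vertex is determined by the source and the label. *)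
Section Cayley.
Variable X : Type.

Definition label : Type := (X + seq X)%type.

Definition edge : Type := (seq X * label)%type.

Definition label_word (y : label) : seq X :=
  match y with inl x => [:: x] | inr u => u end.

Definition src (e : edge) : seq X := e.1.
Definition tgt (e : edge) : seq X := e.1 ++ label_word e.2.

Record subgraph := Subgraph {
  verts : set (seq X);
  edges : set edge;
  src_verts : forall e, edges e -> verts (src e);
  tgt_verts : forall e, edges e -> verts (tgt e)
}.

Definition adjacent (G : subgraph) (v w : seq X) : Prop :=
  exists e, [/\ edges G e, src e = v & tgt e = w].

Definition reachable (G : subgraph) : seq X -> seq X -> Prop :=
  clos_refl_trans (seq X) (adjacent G).

Definition accessible (G : subgraph) : Prop :=
  verts G [::] /\ forall v, verts G v -> reachable G [::] v.

Record fagraph := FAGraph {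
  fagraph_graph :> subgraph;
  finite_verts : finite_set (verts fagraph_graph);
  finite_edges : finite_set (edges fagraph_graph);
  fagraph_acc : accessible fagraph_graph;
  fagraph_edge : edges fagraph_graph !=set0
}.

Lemma subgraph_eq (G H : subgraph) :
  verts G = verts H -> edges G = edges H -> G = H.
Proof.
case: G H => V E s t [V' E' s' t'] /= eV eE.
by subst; congr Subgraph; apply: Prop_irrelevance.
Qed.

Lemma fagraph_eq (G H : fagraph) :
  verts G = verts H -> edges G = edges H -> G = H.
Proof.
case: G H => G a b c d [G' a' b' c' d'] /= eV eE.
have e : G = G' by apply: subgraph_eq.
by subst; congr FAGraph; apply: Prop_irrelevance.
Qed.

Definition union_graph (G H : subgraph) : subgraph.
Proof.
exists (verts G `|` verts H) (edges G `|` edges H).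
- by move=> e [h|h]; [left | right]; apply: src_verts.
- by move=> e [h|h]; [left | right]; apply: tgt_verts.
Defined.

Definition translate_edge (s : seq X) (e : edge) : edge := (s ++ e.1, e.2).

Definition translate (s : seq X) (G : subgraph) : subgraph.
Proof.
exists [set s ++ v | v in verts G] [set translate_edge s e | e in edges G].
- by move=> _ [e he <-]; exists (src e) => //; apply: src_verts.
- move=> _ [e he <-]; exists (tgt e); first exact: tgt_verts.
  by rewrite /tgt /= catA.
Defined.

Definition edge_graph (e : edge) : subgraph.
Proof.
exists [set src e; tgt e] [set e].
- by move=> _ ->; left.
- by move=> _ ->; right.
Defined.

Lemma reachable_mono (G H : subgraph) v w :
  edges G `<=` edges H -> reachable G v w -> reachable H v w.
Proof.
move=> sGH; elim=> [a b [e [he ? ?]]|a|a b c _ h _ k].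
- by apply: rt_step; exists e; split=> //; apply: sGH.
- exact: rt_refl.
- exact: rt_trans h k.
Qed.

Lemma reachable_translate (G : subgraph) s v w :
  reachable G v w -> reachable (translate s G) (s ++ v) (s ++ w).
Proof.
elim=> [a b [e [he <- <-]]|a|a b c _ h _ k].
- apply: rt_step; exists (translate_edge s e); split=> //; first by exists e.
  by rewrite /tgt /= catA.
- exact: rt_refl.
- exact: rt_trans h k.
Qed.

Record Mpair := MPair {
  mgraph : fagraph;
  mend : seq X;
  mend_vert : verts mgraph mend
}.

Lemma Mpair_eq (p q : Mpair) : verts (mgraph p) = verts (mgraph q) ->
  edges (mgraph p) = edges (mgraph q) -> mend p = mend q -> p = q.
Proof.
case: p q => G s h [G' s' h'] /= eV eE es.
have e : G = G' by apply: fagraph_eq.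
by subst; congr MPair; apply: Prop_irrelevance.
Qed.

Lemma union_translate_acc (A B : subgraph) s : accessible A -> accessible B ->
  verts A s -> accessible (union_graph A (translate s B)).
Proof.
move=> [A0 hA] [B0 hB] As; split; first by left.
move=> v [hv|[w hw <-]].
  by apply: reachable_mono (hA _ hv); move=> e; left.
apply: (@rt_trans _ _ _ s).
  by apply: reachable_mono (hA _ As); move=> e; left.
have := reachable_translate s (hB _ hw); rewrite cats0.
by apply: reachable_mono => e; right.
Qed.

Definition Mmul_graph (p q : Mpair) : fagraph.
Proof.
exists (union_graph (mgraph p) (translate (mend p) (mgraph q))).
- rewrite /= finite_setU; split; first exact: finite_verts.
  by apply: finite_image; apply: finite_verts.
- rewrite /= finite_setU; split; first exact: finite_edges.
  by apply: finite_image; apply: finite_edges.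
- by apply: union_translate_acc; [exact: fagraph_acc.. | exact: mend_vert].
- by case: (fagraph_edge (mgraph p)) => e he; exists e; left.
Defined.

Definition Mmul (p q : Mpair) : Mpair.
Proof.
exists (Mmul_graph p q) (mend p ++ mend q).
by right; exists (mend q) => //; apply: mend_vert.
Defined.

Definition Mplus (p : Mpair) : Mpair.
Proof. by exists (mgraph p) [::]; case: (fagraph_acc (mgraph p)). Defined.

Lemma translate_edge_cat s t e :
  translate_edge s (translate_edge t e) = translate_edge (s ++ t) e.
Proof. by rewrite /translate_edge /= catA. Qed.

Lemma translate_edge0 e : translate_edge [::] e = e.
Proof. by case: e. Qed.

Lemma image_cat0 (A : set (seq X)) : [set [::] ++ v | v in A] = A.
Proof. exact: image_id. Qed.

Lemma image_translate0 (A : set edge) : [set translate_edge [::] e | e in A] = A.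
Proof.
by under eq_fun do rewrite translate_edge0; exact: image_id.
Qed.

Definition M : restrSemigroup.
Proof.
exists Mpair Mmul Mplus.
- move=> p q r; apply: Mpair_eq => /=; last exact: catA.
  + rewrite image_setU setUA image_comp; congr (_ `|` _).
    by congr (image _ _); apply/funext => v /=; rewrite catA.
  + rewrite image_setU setUA image_comp; congr (_ `|` _).
    by congr (image _ _); apply/funext => v /=; rewrite translate_edge_cat.
- by move=> p; apply: Mpair_eq; rewrite //= ?image_cat0 ?image_translate0 setUid.
- by move=> p q; apply: Mpair_eq;
    rewrite //= ?image_cat0 ?image_translate0 setUC.
- by move=> p q; apply: Mpair_eq; rewrite //= ?image_cat0 ?image_translate0.
- by move=> p q; apply: Mpair_eq; rewrite //= ?cats0 ?image_cat0
    ?image_translate0 // setUAC setUid.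
Defined.

Definition edge_fagraph (y : label) : fagraph.
Proof.
exists (edge_graph ([::], y)).
- exact: finite_set2.
- exact: finite_set1.
- split; first by left.
  move=> v [->|->]; first exact: rt_refl.
  by apply: rt_step; exists ([::], y).
- by exists ([::], y).
Defined.

Definition Mgen (y : label) : M.
Proof. by exists (edge_fagraph y) (label_word y); right. Defined.

End Cayley.

Arguments M X : clear implicits.

Section Closure.
Variable X : Type.
Implicit Types G H K : subgraph X.

Definition adds_edge G (e : edge X) H : Prop :=
  [/\ ~ edges G e, verts H = verts G & edges H = edges G `|` [set e]].

Inductive step G H : Prop :=
| StepT1 (v u : seq X) :
    edges G (v, inr u) -> adds_edge G (v, inr [::]) H -> step G H
| StepT2 (v : seq X) (x : X) :
    edges G (v, inl x) -> adds_edge G (v, inr [:: x]) H -> step G H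
| StepT3 (w u v : seq X) :
    edges G (w, inr u) -> edges G (w ++ u, inr v) ->
    adds_edge G (w, inr (u ++ v)) H -> step G H.

Definition reduces : subgraph X -> subgraph X -> Prop :=
  clos_refl_trans (subgraph X) step.

Definition irreducible G : Prop := ~ exists H, step G H.

Definition normal_form G H : Prop := reduces G H /\ irreducible H.

Lemma adds_edge_exists G e : verts G (src e) -> verts G (tgt e) ->
  ~ edges G e -> exists H, adds_edge G e H.
Proof.
move=> hs ht ne.
have h1 e' : (edges G `|` [set e]) e' -> verts G (src e').
  by move=> [|->] //; apply: src_verts.
have h2 e' : (edges G `|` [set e]) e' -> verts G (tgt e').
  by move=> [|->] //; apply: tgt_verts.
by exists (Subgraph h1 h2).
Qed.

Lemma irreducibleP G : irreducible G <->
  [/\ forall v u, edges G (v, inr u) -> edges G (v, inr [::]),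
      forall v x, edges G (v, inl x) -> edges G (v, inr [:: x]) &
      forall w u v, edges G (w, inr u) -> edges G (w ++ u, inr v) ->
        edges G (w, inr (u ++ v))].
Proof.
split=> [irr|[h1 h2 h3] [H]]; last first.
  by case=> [v u /h1|v x /h2|w u v hu /(h3 _ _ _ hu)] h [].
split.
- move=> v u h; apply: contrapT => ne; apply: irr.
  have [|//|H hH] := @adds_edge_exists G (v, inr [::]) (src_verts h).
    by rewrite /tgt /= cats0; apply: (src_verts h).
  by exists H; apply: StepT1 h hH.
- move=> v x h; apply: contrapT => ne; apply: irr.
  have [|//|H hH] := @adds_edge_exists G (v, inr [:: x]) (src_verts h).
    exact: (tgt_verts h).
  by exists H; apply: StepT2 h hH.
- move=> w u v h k; apply: contrapT => ne; apply: irr.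
  have [|//|H hH] := @adds_edge_exists G (w, inr (u ++ v)) (src_verts h).
    by have := tgt_verts k; rewrite /tgt /= catA.
  by exists H; apply: StepT3 h k hH.
Qed.

Lemma reduces_verts G H : reduces G H -> verts H = verts G.
Proof.
elim=> [A B []|//|A B C _ e1 _ e2]; last by rewrite e2.
- by move=> v u _ [].
- by move=> v u _ [].
- by move=> w u v _ _ [].
Qed.

Lemma reduces_incl G H : reduces G H -> edges G `<=` edges H.
Proof.
elim=> [A B|A e|A B C _ e1 _ e2 e] //; last by move/e1/e2.
by case=> [v u _|v x _|w u v _ _] [_ _ ->]; left.
Qed.

Lemma reduces_least G H K : reduces G H -> irreducible K ->
  edges G `<=` edges K -> edges H `<=` edges K.
Proof.
move=> gh /irreducibleP[h1 h2 h3].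
elim: gh => [A B|//|A B C _ e1 _ e2 /e1/e2 //].
case=> [v u hu|v x hx|w u v hu hv] [_ _ ->] s e [|->]; try exact: s.
- exact: h1 (s _ hu).
- exact: h2 (s _ hx).
- exact: h3 (s _ hu) (s _ hv).
Qed.

Lemma normal_form_unique G H K : normal_form G H -> normal_form G K -> H = K.
Proof.
move=> [gh ih] [gk ik]; apply: subgraph_eq.
  by rewrite (reduces_verts gh) (reduces_verts gk).
apply/seteqP; split.
  exact: reduces_least gh ik (reduces_incl gk).
exact: reduces_least gk ih (reduces_incl gh).
Qed.

Lemma finite_list (T : Type) (A : set T) : finite_set A ->
  exists l : seq T, forall x, A x <-> List.In x l.
Proof.
move=> /(@finite_seqP {classic T})[l ->]; exists l => x.
elim: l => //= a l IH; rewrite inE; split.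
  by move=> /orP[/eqP->|h]; [left | right; apply/IH].
by move=> [->|h]; apply/orP; [left | right; apply/IH].
Qed.

(* All edges that can be added join vertices of G, and such a barred edge is
   determined by its endpoints, so only finitely many can be added. *)
Lemma normal_form_exists (G : fagraph X) : exists H, normal_form G H.
Proof.
pose U : set (edge X) := edges G `|`
  [set (w.1, inr (drop (size w.1) w.2)) | w in verts G `*` verts G].
have : finite_set U.
  rewrite finite_setU; split; first exact: finite_edges.
  by apply: finite_image; apply: finite_setX; apply: finite_verts.
move=> /finite_list[l lU].
pose miss (H : subgraph X) := count (fun e => `[< ~ edges H e >]) l.
have stepU H K : verts H = verts G -> step H K ->
    exists2 e, U e & adds_edge H e K.
  move=> vH; have bar w u : verts H w -> verts H (w ++ u) -> U (w, inr u).
    rewrite vH => a b; right; exists (w, w ++ u) => //=.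
    by rewrite drop_size_cat.
  case=> [v u h|v x h|w u v h k] a; eexists; try exact: a; apply: bar.
  - exact: (src_verts h).
  - by rewrite cats0; apply: (src_verts h).
  - exact: (src_verts h).
  - exact: (tgt_verts h).
  - exact: (src_verts h).
  - by have := tgt_verts k; rewrite /tgt /= catA.
have stepm H K e : U e -> adds_edge H e K -> (miss K < miss H)%N.
  move=> /lU il [ne _ eK]; rewrite /miss eK; clear miss lU.
  have le : subpred (fun e' => `[< ~ (edges H `|` [set e]) e' >])
      (fun e' => `[< ~ edges H e' >]).
    by move=> e' /asboolP h; apply/asboolP => h'; apply: h; left.
  elim: l il => //= a l IH [->|il].
    rewrite (asboolT ne) asboolF /= ?add0n ?add1n ?ltnS; last by apply; right.
    exact: sub_count.
  rewrite -addnS; apply: leq_add (IH il).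
  case: asboolP => //= h; rewrite asboolT // => h'; apply: h; left; exact: h'.
suff main n (H : subgraph X) : (miss H < n)%N -> reduces G H ->
    exists H', normal_form G H' by apply: (main _ G (ltnSn _)); apply: rt_refl.
elim: n H => // n IH H; rewrite ltnS => hn gh.
have [[K sK]|irr] := pselect (exists K, step H K); last by exists H.
have [e Ue aK] := stepU _ _ (reduces_verts gh) sK.
apply: (IH K); first exact: leq_trans (stepm _ _ _ Ue aK) hn.
by apply: rt_trans gh (rt_step _ _ _ _ sK).
Qed.

Definition wedge (G : fagraph X) : subgraph X :=
  projT1 (cid (normal_form_exists G)).

Lemma wedgeP (G : fagraph X) H : normal_form G H <-> H = wedge G.
Proof.
rewrite /wedge; case: cid => K nK /=; split=> [nH|-> //].
exact: normal_form_unique nH nK.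
Qed.

End Closure.

(* The free object: terms modulo the identities valid in all F-restriction
   semigroups. *)
Section Free.
Variable X : Type.

Inductive term : Type :=
| TVar of X
| TMul of term & term
| TPlus of term
| TMax of term
| TLam.

Fixpoint term_val (R : fRestr) (f : X -> R) (t : term) : R :=
  match t with
  | TVar x => f x
  | TMul a b => term_val f a * term_val f b
  | TPlus a => (term_val f a)^#
  | TMax a => fmax (term_val f a)
  | TLam => flam R
  end.

Definition teq (a b : term) : Prop :=
  forall (R : fRestr) (f : X -> R), term_val f a = term_val f b.

Definition tclass : Type := {C : set term | exists a, C = teq a}.

Definition cls (a : term) : tclass := exist _ (teq a) (ex_intro _ a erefl).

Definition rep (C : tclass) : term := projT1 (cid (projT2 C)).

Lemma cls_eq a b : cls a = cls b <-> teq a b.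
Proof.
split=> [[e]|e].
  by have : teq b b by []; rewrite -e.
apply: eq_exist => /=; apply/funext => c; apply/propext.
by split=> h R f; rewrite -h.
Qed.

Lemma repK C : cls (rep C) = C.
Proof.
case: C => C hC; apply: eq_exist => /=.
by rewrite /rep /=; case: cid.
Qed.

Lemma rep_cls a : teq (rep (cls a)) a.
Proof. by apply/cls_eq; rewrite repK. Qed.

Lemma clsP C : exists a, C = cls a.
Proof. by exists (rep C); rewrite repK. Qed.

Definition qmul (C D : tclass) : tclass := cls (TMul (rep C) (rep D)).
Definition qplus (C : tclass) : tclass := cls (TPlus (rep C)).
Definition qmax (C : tclass) : tclass := cls (TMax (rep C)).

Lemma qmulE a b : qmul (cls a) (cls b) = cls (TMul a b).
Proof. by apply/cls_eq => R f /=; rewrite !rep_cls. Qed.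
Lemma qplusE a : qplus (cls a) = cls (TPlus a).
Proof. by apply/cls_eq => R f /=; rewrite !rep_cls. Qed.
Lemma qmaxE a : qmax (cls a) = cls (TMax a).
Proof. by apply/cls_eq => R f /=; rewrite !rep_cls. Qed.

Definition qbase : restrSemigroup.
Proof.
exists tclass qmul qplus.
- move=> C D E; have [a ->] := clsP C; have [b ->] := clsP D.
  have [c ->] := clsP E; rewrite !qmulE; apply/cls_eq => R f /=.
  exact: rmulA.
- move=> C; have [a ->] := clsP C; rewrite !(qmulE, qplusE).
  by apply/cls_eq => R f /=; exact: rplusK.
- move=> C D; have [a ->] := clsP C; have [b ->] := clsP D.
  by rewrite !(qmulE, qplusE); apply/cls_eq => R f /=; exact: rplusC.
- move=> C D; have [a ->] := clsP C; have [b ->] := clsP D.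
  by rewrite !(qmulE, qplusE); apply/cls_eq => R f /=; exact: rplusM.
- move=> C D; have [a ->] := clsP C; have [b ->] := clsP D.
  by rewrite !(qmulE, qplusE); apply/cls_eq => R f /=; exact: rplusJ.
Defined.

Lemma qmax_max (C : qbase) : is_class_max C (qmax C : qbase).
Proof.
have [a ->] := clsP C; split.
  exists (cls (TPlus a)); first by exists (cls a); rewrite /= qplusE.
  rewrite /= qmaxE !qmulE; apply/cls_eq => R f /=.
  by rewrite rplusK; apply: nleE; apply: nle_fmax.
move=> D; have [b ->] := clsP D => -[_ [E ->]]; have [c ->] := clsP E.
rewrite /= !(qmulE, qplusE) => /cls_eq h.
exists (cls (TPlus b)); first by exists (cls b); rewrite /= qplusE.
rewrite /= qmaxE qmulE; apply/cls_eq => R f /=.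
have -> : fmax (term_val f a) = fmax (term_val f b).
  apply: fmax_eq; exists (term_val f c)^#; first exact: proj_plus.
  exact: (h R f).
by apply: nleE; apply: nle_fmax.
Qed.

Lemma qlam_max : is_max_proj (cls TLam : qbase).
Proof.
split.
  exists (cls TLam); rewrite /= qplusE; apply/cls_eq => R f /=.
  by rewrite projE //; apply: flam_proj.
move=> e pe; exists e => //; case: pe => C ->; have [a ->] := clsP C.
rewrite /= !(qmulE, qplusE); apply/cls_eq => R f /=.
by rewrite ple_flam //; apply: proj_plus.
Qed.

Definition qfree : fRestr := FRestr qmax_max qlam_max.

Lemma qfree_free : is_free (F := qfree) (fun x => cls (TVar x)).
Proof.
move=> R f; exists (fun C : qfree => term_val f (rep C)); split.
  split; last by move=> x; rewrite rep_cls.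
  split=> /=; last by rewrite rep_cls.
  - by split=> [C D|C] /=; rewrite /qmul /qplus rep_cls.
  - by move=> C; rewrite /qmax rep_cls.
move=> h [[[hm hp] hx hl] hv]; apply/funext => C.
rewrite -{2}(repK C); elim: (rep C) => /= [x|a IHa b IHb|a IHa|a IHa|].
- by rewrite hv.
- by rewrite IHa IHb -hm /= qmulE.
- by rewrite IHa -hp /= qplusE.
- by rewrite IHa -hx /= qmaxE.
- by rewrite -hl.
Qed.

Lemma FFR_exists :
  exists Fi : {F : fRestr & X -> F}, is_free (projT2 Fi).
Proof.
exists (existT (fun F : fRestr => X -> F) qfree (fun x => cls (TVar x))).
exact: qfree_free.
Qed.

End Free.

Definition FFR_pair (X : Type) : {F : fRestr & X -> F} :=
  projT1 (cid (FFR_exists X)).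
Definition FFR (X : Type) : fRestr := projT1 (FFR_pair X).
Definition FFR_gen (X : Type) : X -> FFR X := projT2 (FFR_pair X).

Lemma FFR_free (X : Type) : is_free (@FFR_gen X).
Proof. exact: (projT2 (cid (FFR_exists X))). Qed.

Section Canonical.
Variables (X : Type) (R : fRestr) (f : X -> R).

Definition is_canonical (phi : M X -> R) : Prop :=
  [/\ is_rmorph phi,
      forall x, phi (Mgen (inl x)) = f x &
      forall u, phi (Mgen (inr u)) = fmax (word_val f u)].

(* A canonical morphism is constructed as (A, s) |-> (meet of ev e for e an
   edge of A) * wm s. *)

Let wm (u : seq X) : R := fmax (word_val f u).

Let lm (y : label X) : R := match y with inl x => f x | inr u => wm u end.

Let ev (e : edge X) : R := (wm (src e) * lm e.2)^#.

Lemma wm0 : wm [::] = flam R. Proof. exact: fmax_flam. Qed.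

Lemma wm_cat u v : wm u * wm v = (wm u * wm v)^# * wm (u ++ v).
Proof.
have -> : wm (u ++ v) = fmax (word_val f u * word_val f v).
  by apply: fmax_eq; apply: word_val_cat.
exact: fmax_mul.
Qed.

Lemma lm_le y : nle (lm y) (wm (label_word y)).
Proof.
case: y => [x|u] /=; first exact: nle_fmax.
by exists (wm u)^#; [exact: proj_plus | rewrite rplusK].
Qed.

Lemma ple_wm_lm e v y :
  ple e (wm v * lm y)^# -> ple e (wm (v ++ label_word y))^#.
Proof.
move=> /(ple_mulr (lm_le y)); rewrite wm_cat rplusM => h.
apply: ple_trans h _; by rewrite /ple -rmulA rpp.
Qed.

Fixpoint meet (l : seq (edge X)) : R :=
  if l is e :: l' then ev e * meet l' else flam R.

Lemma meet_proj l : is_proj (meet l).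
Proof.
elim: l => [|e l IH] /=; first exact: flam_proj.
by apply: projM => //; apply: proj_plus.
Qed.

Lemma ple_meet l g : is_proj g ->
  ple g (meet l) <-> forall e, List.In e l -> ple g (ev e).
Proof.
move=> pg; elim: l => [|e l IH] /=; first by split=> // _; apply: ple_flam.
rewrite pleM; [|exact: proj_plus|exact: meet_proj].
split=> [[h /IH k] e' [<- //|/k //]|h].
by split; [apply: h; left | apply/IH => e' he'; apply: h; right].
Qed.

Lemma ple_mul_meet x l g : is_proj g ->
  ple g (x * meet l)^# <->
  ple g (x * flam R)^# /\ forall e, List.In e l -> ple g (x * ev e)^#.
Proof.
move=> pg; elim: l => [|e l IH] /=; first by split=> [h|[]//].
have -> : (x * (ev e * meet l))^# = (x * ev e)^# * (x * meet l)^#.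
  by rewrite -rplusM !rmulA -(projJ x (proj_plus _)).
rewrite pleM; [|exact: proj_plus..]; split=> [[h /IH[k k']]|[h k]].
  by split=> // e' [<- //|/k'].
by split; [apply: k; left | apply/IH; split=> // e' he'; apply: k; right].
Qed.

Definition meet_set (A : set (edge X)) (fA : finite_set A) : R :=
  meet (projT1 (cid (finite_list fA))).

Lemma meet_set_proj A (fA : finite_set A) : is_proj (meet_set fA).
Proof. exact: meet_proj. Qed.

Lemma ple_meet_set A (fA : finite_set A) g : is_proj g ->
  ple g (meet_set fA) <-> forall e, A e -> ple g (ev e).
Proof.
move=> pg; rewrite /meet_set; case: cid => l hl /=.
by rewrite ple_meet //; split=> h e /hl; apply: h.
Qed.

Lemma ple_mul_meet_set x A (fA : finite_set A) g : is_proj g ->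
  ple g (x * meet_set fA)^# <->
  ple g (x * flam R)^# /\ forall e, A e -> ple g (x * ev e)^#.
Proof.
move=> pg; rewrite /meet_set; case: cid => l hl /=.
by rewrite ple_mul_meet //; split=> -[? h]; split=> // e /hl; apply: h.
Qed.

Definition can_fun (p : M X) : R :=
  meet_set (finite_edges (mgraph p)) * wm (mend p).

Lemma wm_ev s e :
  (wm s * ev e)^# = (wm s * wm (src e))^# * ev (translate_edge s e).
Proof.
rewrite [X in _ * X]/ev -rplusM rmulA -[src (translate_edge s e)]/(s ++ src e).
by rewrite -wm_cat rplusMr rmulA.
Qed.

Lemma reach_le (G : subgraph X) g s v : (forall e, edges G e ->
    ple g (ev (translate_edge s e))) -> is_proj g ->
  reachable G [::] v -> ple g (wm s * flam R)^# -> ple g (wm s * wm v)^#.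
Proof.
move=> hG pg hr h0.
have gen a b : reachable G a b -> ple g (wm s * wm a)^# -> ple g (wm s * wm b)^#.
  elim=> [c d [e [he <- <-]] h|//|c d d' _ h1 _ h2 /h1/h2 //].
  have : ple g (wm s * ev e)^#.
    rewrite wm_ev pleM; [|exact: proj_plus..].
    by split=> //; apply: hG.
  rewrite /ev rplusMr rmulA => /(ple_mulr (lm_le _)).
  rewrite -rmulA; apply: ple_mulr.
  exists (wm (src e) * wm (label_word e.2))^#; first exact: proj_plus.
  exact: wm_cat.
by apply: gen hr _; rewrite wm0.
Qed.

Lemma meet_le_wm (A : fagraph X) g s : verts A s -> is_proj g ->
  (forall e, edges A e -> ple g (ev e)) -> ple g (wm s)^#.
Proof.
move=> As pg hA.
have h := @reach_le A g [::] s _ pg ((fagraph_acc A).2 _ As).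
have : ple g (wm [::] * wm s)^#.
  apply: h => [e he|]; first by rewrite translate_edge0; apply: hA.
  by rewrite wm0 flamL projE; [apply: ple_flam | apply: flam_proj].
by rewrite wm0 flamL.
Qed.

Lemma root_edge (A : fagraph X) : exists y, edges A ([::], y).
Proof.
have [e0 he0] := fagraph_edge A.
have gen a b : reachable A a b -> a = [::] ->
    (exists y, edges A ([::], y)) \/ b = [::].
  elim=> [c d [[v y] [he /= <- _]] e|c ->|c d d' _ h1 _ h2 /h1[|/h2]];
    [|by right|by left|by []].
  by left; exists y; rewrite -e.
have [//|e] := gen _ _ ((fagraph_acc A).2 _ (src_verts he0)) erefl.
by exists e0.2; rewrite -e; case: (e0) he0.
Qed.

Lemma can_mul p q : can_fun (p * q) = can_fun p * can_fun q.
Proof.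
rewrite /can_fun; set EA := meet_set (finite_edges (mgraph p)).
set EB := meet_set (finite_edges (mgraph q)); set s := mend p; set t := mend q.
have pB : is_proj EB by apply: meet_set_proj.
have pA : is_proj EA by apply: meet_set_proj.
rewrite -(rmulA EA) (rmulA _ EB) (projJ _ pB) -(rmulA _ _ (wm t)) wm_cat.
rewrite !rmulA; congr (_ * _).
set EAB := meet_set _.
apply: ple_anti; first exact: meet_set_proj.
  by do !apply: projM; rewrite ?pA //; exact: proj_plus.
move=> g pg; rewrite ple_meet_set //.
rewrite pleM; [|by apply: projM => //; apply: proj_plus|exact: proj_plus].
rewrite pleM //; last exact: proj_plus.
rewrite ple_meet_set // ple_mul_meet_set //; split=> [h|[[hA [h0 hB]] _] e].
  have hA e : edges (mgraph p) e -> ple g (ev e) by move=> he; apply: h; left.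
  have hB e : edges (mgraph q) e -> ple g (ev (translate_edge s e)).
    by move=> he; apply: h; right; exists e.
  have h0 : ple g (wm s * flam R)^#.
    have [y /hB] := root_edge (mgraph q).
    rewrite /ev /= cats0 -{1}(flamL (lm y)) rmulA; exact: ple_mull.
  have hq v : verts (mgraph q) v -> ple g (wm s * wm v)^#.
    by move=> hv; apply: (reach_le hB) => //; apply: (fagraph_acc _).2.
  split; last by apply: hq; apply: mend_vert.
  split=> //; split=> // e he; rewrite wm_ev pleM; [|exact: proj_plus..].
  by split; [apply: hq; apply: src_verts | apply: hB].
case=> [/hA //|[e' /hB + <-]]; rewrite wm_ev pleM; last exact: proj_plus.
  by case.
exact: proj_plus.
Qed.

Lemma can_plus p : can_fun p^# = (can_fun p)^#.
Proof.
have pA := meet_set_proj (finite_edges (mgraph p)).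
rewrite /can_fun projMl //= wm0 (ple_flam pA).
apply/esym; rewrite -/(ple _ _).
apply: (@meet_le_wm (mgraph p)) => //; first exact: mend_vert.
by apply/(ple_meet_set (finite_edges _) pA); rewrite /ple projI.
Qed.

Lemma meet_set1 e A (fA : finite_set A) : A = [set e] -> meet_set fA = ev e.
Proof.
move=> eA; apply: ple_anti; [exact: meet_set_proj|exact: proj_plus|].
move=> g pg; rewrite ple_meet_set // eA; split=> [h|h _ -> //]; exact: h.
Qed.

Lemma can_gen y : can_fun (Mgen y) = lm y.
Proof.
rewrite /can_fun (@meet_set1 ([::], y)) //= /ev /= wm0 flamL.
by apply/esym/nleE/lm_le.
Qed.

Lemma canonical_exists : exists phi : M X -> R, is_canonical phi.
Proof.
exists can_fun; split; first by split; [exact: can_mul | exact: can_plus].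
- by move=> x; rewrite can_gen.
- by move=> u; rewrite can_gen.
Qed.

End Canonical.

Section Generation.
Variable X : Type.
Implicit Types (G : subgraph X) (q : M X).

Inductive generated : M X -> Prop :=
| GenEdge y : generated (Mgen y)
| GenMul p q : generated p -> generated q -> generated (p * q)
| GenPlus p : generated p -> generated p^#.

Let inside G q :=
  verts (mgraph q) `<=` verts G /\ edges (mgraph q) `<=` edges G.

Lemma reachable_verts G v w : reachable G v w -> verts G v -> verts G w.
Proof.
elim=> [a b [e [he _ <-]] _|//|a b c _ h _ k /h/k //].
exact: tgt_verts.
Qed.

Lemma inside_mul G p q : inside G p -> inside G q ->
  mend p = [::] -> inside G (p * q).
Proof.
move=> [v e] [v' e'] h; split=> /= a [|]; rewrite ?h ?image_cat0
  ?image_translate0; by [exact: v|exact: v'|exact: e|exact: e'].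
Qed.

Lemma edge_elem G e : edges G e ->
  src e = [::] \/ (exists q, [/\ generated q, inside G q & mend q = src e]) ->
  exists q, [/\ generated q, inside G q, edges (mgraph q) e & mend q = tgt e].
Proof.
case: e => w y he [/= w0|[q [gq [vq eq] /= qw]]].
  rewrite /src /= in w0; rewrite w0 in he *.
  exists (Mgen y); split=> //; first exact: GenEdge.
  split=> a /=; last by move=> ->.
  by move=> [->|->]; [exact: (src_verts he) | exact: (tgt_verts he)].
rewrite /src /= in qw.
exists (q * Mgen y); split; first exact: GenMul gq (GenEdge y).
- split=> a /= [|[b]]; [exact: vq| |exact: eq|].
    rewrite qw => -[->|->] <-; last exact: (tgt_verts he).
    by rewrite /src /= cats0; apply: (src_verts he).
  by rewrite qw => -> <-; rewrite /translate_edge /= cats0.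
- right; exists ([::], y) => //=.
  by rewrite /translate_edge /= cats0 qw.
- by rewrite /= qw.
Qed.

Lemma path_elem G v : reachable G [::] v -> v = [::] \/
  exists q, [/\ generated q, inside G q & mend q = v].
Proof.
move=> /(@clos_rt_rtn1 _ _ _ _); elim=> [|a b [e [he ea eb]] _ IH].
  by left.
right; rewrite -ea in IH; have [q [gq iq _ qe]] := edge_elem he IH.
by exists q; split=> //; rewrite qe.
Qed.

Lemma all_generated p : generated p.
Proof.
case: p => A s As; have acc := fagraph_acc A.
have edgeq e : edges A e ->
    exists q, [/\ generated q, inside A q, edges (mgraph q) e & mend q = [::]].
  move=> he; have [q [gq iq qe _]] :=
    edge_elem he (path_elem (acc.2 _ (src_verts he))).
  by exists q^#; split=> //; apply: GenPlus.
have listq (l : seq (edge X)) : (forall e, List.In e l -> edges A e) ->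
    exists q, [/\ generated q, inside A q,
      forall e, List.In e l -> edges (mgraph q) e & mend q = [::]].
  elim: l => [|e l IH] h.
    by have [e /edgeq[q [gq iq _ q0]]] := fagraph_edge A; exists q.
  have [|q [gq iq hq q0]] := IH; first by move=> e' he'; apply: h; right.
  have [|q' [gq' iq' eq' q0']] := edgeq e; first by apply: h; left.
  exists (q' * q); split; [exact: GenMul|exact: inside_mul| |].
    by move=> e' [<-|/hq h']; [left|right; exists e' => //; rewrite q0' translate_edge0].
  by rewrite /= q0 q0'.
have [l hl] := finite_list (finite_edges A).
have [|q [gq [vq eq] lq q0]] := listq l; first by move=> e /hl.
have eA : edges (mgraph q) = edges A.
  by apply/seteqP; split=> // e /hl; apply: lq.
have vA : verts (mgraph q) = verts A.
  apply/seteqP; split=> // v /acc.2 h.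
  apply: (@reachable_verts _ [::]); last exact: (fagraph_acc _).1.
  by apply: reachable_mono h; rewrite eA.
have [s0|[r [gr [vr er] rs]]] := path_elem (acc.2 _ As).
  suff -> : MPair As = q by [].
  by apply: Mpair_eq => //=; rewrite q0.
suff -> : MPair As = q * r :> M X by apply: GenMul.
apply: Mpair_eq => /=; rewrite ?q0 ?image_cat0 ?image_translate0 ?rs //.
  by rewrite vA; apply/esym/setUidPl.
by rewrite eA; apply/esym/setUidPl.
Qed.

Lemma canonical_unique (R : fRestr) (f : X -> R) (phi psi : M X -> R) :
  is_canonical f phi -> is_canonical f psi -> phi = psi.
Proof.
move=> [[m p] gx gu] [[m' p'] gx' gu']; apply/funext => q.
elim: (all_generated q) => [[x|u]|a b _ IHa _ IHb|a _ IH].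
- by rewrite gx gx'.
- by rewrite gu gu'.
- by rewrite m m' IHa IHb.
- by rewrite p p' IH.
Qed.

End Generation.

Definition FFR_morph (X : Type) : M X -> FFR X :=
  projT1 (cid (canonical_exists (@FFR_gen X))).

Lemma FFR_morphP (X : Type) : is_canonical (@FFR_gen X) (@FFR_morph X).
Proof. exact: (projT2 (cid (canonical_exists (@FFR_gen X)))). Qed.

(* FFR_morph is the only canonical morphism, by canonical_unique. *)
Definition rho (X : Type) (p q : M X) : Prop := FFR_morph p = FFR_morph q.

(* Main.v *)
Require Import Defs.
From mathcomp Require Import all_boot.
From mathcomp Require Import boolp classical_sets functions cardinality.

(** Identify a graph with its set of edges; then $A^{\wedge}$ is the least
    superset of the edges of $A$ closed under (T1)-(T3) ([edges_wedge]), and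
    its vertices can be recovered from its edges because $A$ is accessible
    ([wedge_eqP]).

    If the closures agree, then so do the images in the free object.  In any
    F-restriction semigroup, write $\hat u$ for the maximum element of the
    $\sigma$-class of the value of a word $u$.  The canonical morphism sends
    $(A, s)$ to a meet of projections, one for each edge of $A$, times
    $\hat s$.  For a projection $g$, the edges whose projection is above $g$
    form a closed set: this is where $x \le \hat x$,
    $\hat u \hat v \le \widehat{uv}$ and $\hat\lambda = \lambda$ are used
    ([above_closed]).  Hence the projections below the meet over $A$ depend
    only on $A^{\wedge}$, and so does the meet.

    Conversely, closed sets of edges form an F-restriction semigroup.  Take
    the pairs $(E, s)$ in which $E$ is closed and has an edge from $\lambda$
    labeled by the barred copy of $s$, and likewise of the source of each of
    its edges; multiply by $(E, s)(F, t) = (\langle E \cup sF\rangle, st)$.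
    Two pairs are $\sigma$-related iff they have the same end $s$, and the
    maximum of that class is the closure of the single barred edge from
    $\lambda$ to $s$.  By freeness the canonical morphism to this semigroup
    factors through the free one, and it maps $(A, s)$ to the pair formed by
    the closure of $A$ and $s$ ([model_image]), from which $s$ and
    $A^{\wedge}$ can be read off. *)

Set Implicit Arguments.
Unset Strict Implicit.
Unset Printing Implicit Defensive.

(** * Closed sets of edges *)

Section ClosedSets.
Local Open Scope classical_set_scope.
Variable X : Type.
Implicit Types (E F K : set (edge X)) (A B : fagraph X).

Definition edge_closed E : Prop :=
  [/\ forall v u, E (v, inr u) -> E (v, inr [::]),
      forall v x, E (v, inl x) -> E (v, inr [:: x]) &
      forall w u v, E (w, inr u) -> E (w ++ u, inr v) -> E (w, inr (u ++ v))].

Definition edge_closure E : set (edge X) :=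
  [set e | forall K, edge_closed K -> E `<=` K -> K e].

Definition shift (s : seq X) E : set (edge X) :=
  [set translate_edge s e | e in E].

Lemma closure_closed E : edge_closed (edge_closure E).
Proof.
split=> [v u h K cK EK|v x h K cK EK|w u v h k K cK EK]; case: (cK) => c1 c2 c3.
- by apply: c1 (h K cK EK).
- by apply: c2 (h K cK EK).
- by apply: c3 (h K cK EK) (k K cK EK).
Qed.

Lemma sub_closure E : E `<=` edge_closure E.
Proof. by move=> e Ee K _; apply. Qed.

Lemma closure_least E K : edge_closed K -> E `<=` K -> edge_closure E `<=` K.
Proof. by move=> cK EK e; apply. Qed.

Lemma closure_mono E F : E `<=` F -> edge_closure E `<=` edge_closure F.
Proof.
move=> EF; apply: closure_least (closure_closed F) _.
by move=> e /EF; apply: sub_closure.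
Qed.

Lemma closure_id E : edge_closed E -> edge_closure E = E.
Proof.
by move=> cE; apply/seteqP; split; [apply: closure_least | apply: sub_closure].
Qed.

(** The transformations (T1)-(T3) only see sources relative to each other, so
    they commute with left translation.  This is what lets the inner closures
    in a product of closed sets be dropped, and so makes the product below
    associative. *)
Lemma closed_preshift s K :
  edge_closed K -> edge_closed [set e | K (translate_edge s e)].
Proof.
case=> c1 c2 c3; split=> [v u|v x|w u v]; rewrite /translate_edge /=.
- exact: c1.
- exact: c2.
- by rewrite catA; apply: c3.
Qed.

Lemma closure_setU_shift E F s :
  edge_closure (edge_closure E `|` shift s (edge_closure F)) =
  edge_closure (E `|` shift s F).
Proof.
apply/seteqP; split; last first.
  apply: closure_mono => e [/sub_closure|[e' /sub_closure h <-]]; first by left.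
  by right; exists e'.
apply: closure_least (closure_closed _) _ => e [|[e' h <-]].
  by apply: closure_mono => e' ?; left.
apply: h (closed_preshift s (closure_closed _)) _ => e'' h /=.
by apply: sub_closure; right; exists e''.
Qed.

Lemma closureK E : edge_closure (edge_closure E) = edge_closure E.
Proof. exact: closure_id (closure_closed E). Qed.

Lemma closure_setU_shiftl E F s :
  edge_closure (edge_closure E `|` shift s F) = edge_closure (E `|` shift s F).
Proof. by rewrite -closure_setU_shift closureK closure_setU_shift. Qed.

Lemma closure_setU_shiftr E F s :
  edge_closure (E `|` shift s (edge_closure F)) =
  edge_closure (E `|` shift s F).
Proof. by rewrite -closure_setU_shift closureK closure_setU_shift. Qed.

Lemma shift0 E : shift [::] E = E.
Proof. exact: image_translate0. Qed.

Lemma closure_setUl E F :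
  edge_closure (edge_closure E `|` F) = edge_closure (E `|` F).
Proof. by rewrite -(shift0 F) closure_setU_shiftl. Qed.

Lemma shift_setU s E F : shift s (E `|` F) = shift s E `|` shift s F.
Proof. exact: image_setU. Qed.

Lemma shift_cat s t E : shift s (shift t E) = shift (s ++ t) E.
Proof.
rewrite /shift image_comp; congr (image _ _).
by apply/funext => e /=; rewrite translate_edge_cat.
Qed.

(** (T1)-(T3) only add edges at sources that are already present, so a
    property of sources passes from a set to its closure. *)
Lemma closure_src E (P : set (seq X)) :
  (forall e, E e -> P (src e)) -> forall e, edge_closure E e -> P (src e).
Proof.
by move=> h e he; apply: (he [set e | P (src e)]); first by split.
Qed.

Lemma edges_wedge A : edges (wedge A) = edge_closure (edges A).
Proof.
have [red irr] := (wedgeP A (wedge A)).2 erefl; apply/seteqP; split.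
  move=> e he K cK AK.
  (* K need not come with finitely many vertices: take all words *)
  pose H := @Subgraph X setT K (fun _ _ => I) (fun _ _ => I).
  by apply: (@reduces_least X A (wedge A) H) he => //; apply/irreducibleP.
by apply: closure_least; [apply/irreducibleP | apply: reduces_incl].
Qed.

Lemma verts_wedge A : verts (wedge A) = verts A.
Proof. by have [/reduces_verts] := (wedgeP A (wedge A)).2 erefl. Qed.

(** The edges determine the vertices, because every vertex is reached from
    $\lambda$ along edges. *)
Lemma wedge_eqP A B :
  wedge A = wedge B <-> edge_closure (edges A) = edge_closure (edges B).
Proof.
split=> [e|e]; first by rewrite -!edges_wedge e.
have sub (C D : fagraph X) : edge_closure (edges C) = edge_closure (edges D) ->
    verts (wedge C) `<=` verts (wedge D).
  move=> eCD v; rewrite verts_wedge => /(fagraph_acc C).2 h.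
  apply: (@reachable_verts _ _ [::]); last first.
    by rewrite verts_wedge; apply: (fagraph_acc D).1.
  by apply: reachable_mono h; rewrite edges_wedge -eCD; apply: sub_closure.
apply: subgraph_eq; last by rewrite !edges_wedge.
by apply/seteqP; split; apply: sub.
Qed.

End ClosedSets.

(** * Canonical morphisms *)

Section Composition.
Local Open Scope restr_scope.

Lemma word_val_morph (X : Type) (R S : fRestr) (h : R -> S) (g : X -> R)
    (u : seq X) :
  is_fmorph h -> h (word_val g u) = word_val (fun y => h (g y)) u.
Proof.
move=> [[hm _] _ hl]; case: u => [//|x u] /=.
by elim: u (g x) => //= y u IH a; rewrite IH hm.
Qed.

Lemma canonical_comp (X : Type) (R S : fRestr) (h : R -> S) (g : X -> R)
    (phi : M X -> R) : is_fmorph h -> is_canonical g phi ->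
  is_canonical (fun y => h (g y)) (fun p => h (phi p)).
Proof.
move=> hh [[pm pp] px pu]; case: (hh) => -[hm hp] hx hl; split.
- by split=> [p q|p]; rewrite ?pm ?pp ?hm ?hp.
- by move=> x; rewrite px.
- by move=> u; rewrite pu hx (word_val_morph _ _ hh).
Qed.

End Composition.

Section Invariance.
Local Open Scope classical_set_scope.
Local Open Scope restr_scope.
Variables (X : Type) (R : fRestr) (f : X -> R).

Definition wmax (u : seq X) : R := fmax (word_val f u).

Definition label_val (y : label X) : R :=
  match y with inl x => f x | inr u => wmax u end.

(** For an edge with source $v$, the image under the canonical morphism of the
    projection of the two-edge graph in which it is preceded by the barred
    edge from $\lambda$ to $v$.  Without that edge the graph would not be
    accessible. *)
Definition edge_proj (e : edge X) : R := (wmax (src e) * label_val e.2)^#.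

Lemma wmax_mul_le u v : nle (wmax u * wmax v) (wmax (u ++ v)).
Proof.
exists (wmax u * wmax v)^#; first exact: proj_plus.
exact: wm_cat.
Qed.

(** For each of (T1)-(T3), the projection of the added edge lies above the meet
    of those of the edges that trigger it, so adding it does not change the
    meet over the whole graph. *)
Lemma above_closed (g : R) : edge_closed [set e | ple g (edge_proj e)].
Proof.
split=> [v u|v x|w u v] /=; rewrite /edge_proj /=.
- have -> : wmax u = wmax [::] * wmax u by rewrite /wmax fmax_flam flamL.
  by rewrite rmulA; apply: ple_mull.
- exact/ple_mulr/nle_fmax.
- move=> hu hv; apply: (ple_mulr (wmax_mul_le u v)).
  rewrite rmulA /wmax wm_cat -rmulA rplusM.
  by apply/pleM; [exact: proj_plus..|split].
Qed.

Lemma can_fun_canonical : is_canonical f (can_fun f).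
Proof.
split; first by split; [exact: can_mul | exact: can_plus].
- by move=> x; rewrite can_gen.
- by move=> u; rewrite can_gen.
Qed.

Variable phi : M X -> R.
Hypothesis phiP : is_canonical f phi.

(** Only the projection of the image of $(A, s)$ depends on $A$, so equalities
    of images reduce to comparing projections. *)
Lemma canonical_splits (p : M X) : phi p = (phi p)^# * wmax (mend p).
Proof.
rewrite (canonical_unique phiP can_fun_canonical); apply: nleE.
by exists (meet_set f (finite_edges (mgraph p))); first exact: meet_set_proj.
Qed.

(** The projection of the image of $(A, s)$ is the meet of the projections of
    the edges of $A$: accessibility makes the barred edges from $\lambda$ that
    are built into them, and the end $s$, impose nothing more. *)
Lemma ple_canonical (p : M X) (g : R) : is_proj g ->
  ple g (phi p)^# <-> edges (mgraph p) `<=` [set e | ple g (edge_proj e)].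
Proof.
move=> pg; rewrite (canonical_unique phiP can_fun_canonical) -can_plus.
rewrite /can_fun /= fmax_flam.
have pA := meet_set_proj f (finite_edges (mgraph p)).
rewrite (_ : _ * flam R = meet_set f (finite_edges (mgraph p))).
  by rewrite ple_meet_set.
exact: ple_flam.
Qed.

Lemma canonical_wedge (p q : M X) : mend p = mend q ->
  wedge (mgraph p) = wedge (mgraph q) -> phi p = phi q.
Proof.
move=> est /wedge_eqP eAB; rewrite (canonical_splits p).
rewrite (canonical_splits q) est; congr (_ * _).
apply: ple_anti; [exact: proj_plus..|move=> g pg].
have sub (a b : M X) :
    edge_closure (edges (mgraph a)) = edge_closure (edges (mgraph b)) ->
    ple g (phi a)^# -> ple g (phi b)^#.
  move=> eab; rewrite !ple_canonical // => /(closure_least (above_closed g)).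
  by rewrite eab; apply: subset_trans; apply: sub_closure.
by split; apply: sub.
Qed.

End Invariance.

(** * The F-restriction semigroup of closed sets of edges *)

Section Model.
Local Open Scope classical_set_scope.
Local Open Scope restr_scope.
Variable X : Type.

(** In a closed accessible graph with an edge the vertices are exactly the
    words $v$ with a barred edge from $\lambda$ to $v$; so [cacc] and
    [cvert] express accessibility and membership of the end vertex. *)
Record cpair := CPair {
  cset : set (edge X);
  cend : seq X;
  cclosed : edge_closed cset;
  cacc : forall e, cset e -> cset ([::], inr (src e));
  cvert : cset ([::], inr cend)
}.

Lemma cpair_eq (a b : cpair) : cset a = cset b -> cend a = cend b -> a = b.
Proof.
case: a b => E s c d v [E' s' c' d' v'] /= eE es.
by subst; congr CPair; apply: Prop_irrelevance.
Qed.

Lemma croot (a : cpair) : cset a ([::], inr [::]).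
Proof. by case: (cclosed a) => c1 _ _; apply: c1 (cvert a). Qed.

Definition cmul_set (a b : cpair) : set (edge X) :=
  edge_closure (cset a `|` shift (cend a) (cset b)).

Lemma cmul_path a b v :
  cset b ([::], inr v) -> cmul_set a b ([::], inr (cend a ++ v)).
Proof.
move=> hv; case: (closure_closed (cset a `|` shift (cend a) (cset b))) => _ _.
apply; apply: sub_closure; first by left; apply: cvert.
by right; exists ([::], inr v) => //; rewrite /translate_edge /= cats0.
Qed.

Lemma cmul_acc a b e : cmul_set a b e -> cmul_set a b ([::], inr (src e)).
Proof.
move: e; apply: (@closure_src _ _ [set v | cmul_set a b ([::], inr v)]).
move=> e [h|[e' h <-]]; last exact: cmul_path (cacc h).
by apply: sub_closure; left; apply: cacc.
Qed.

Definition cmul (a b : cpair) : cpair :=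
  CPair (@closure_closed _ _) (@cmul_acc a b) (@cmul_path a _ _ (cvert b)).

Definition cplus (a : cpair) : cpair :=
  CPair (cclosed a) (@cacc a) (croot a).

Lemma closure_cset (a : cpair) : edge_closure (cset a) = cset a.
Proof. exact: closure_id (cclosed a). Qed.

Definition cbase : restrSemigroup.
Proof.
exists cpair cmul cplus.
- move=> a b c; apply: cpair_eq; last exact: catA.
  rewrite /= /cmul_set /= closure_setU_shiftl closure_setU_shiftr.
  by rewrite shift_setU shift_cat setUA.
- by move=> a; apply: cpair_eq; rewrite //= shift0 setUid closure_cset.
- by move=> a b; apply: cpair_eq; rewrite //= !shift0 setUC.
- by move=> a b; apply: cpair_eq.
- move=> a b; apply: cpair_eq; last by rewrite /= cats0.
  by rewrite /= shift0 closure_setUl setUAC setUid.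
Defined.

Lemma proj_cend (e : cbase) : is_proj e -> cend e = [::].
Proof. by case=> a ->. Qed.

Lemma csigmaP (a b : cbase) : sigma a b <-> cend a = cend b.
Proof.
split=> [[e /proj_cend e0 /(congr1 cend)]|eab]; first by rewrite /= e0.
exists (a^# * b^#); first by apply: projM; apply: proj_plus.
apply: cpair_eq; rewrite //= ?eab // !shift0 !closure_setUl.
by rewrite setUAC setUid -setUA setUid.
Qed.

Lemma cnleP (a b : cbase) : cend a = cend b -> cset b `<=` cset a -> nle a b.
Proof.
move=> eab sba; exists a^#; first exact: proj_plus.
apply: cpair_eq => //=.
by rewrite shift0 ((setUidPl _ _).2 sba) closure_cset.
Qed.

Lemma cgen_vert (y : label X) :
  edge_closure [set ([::], y)] ([::], inr (label_word y)).
Proof.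
have h : edge_closure [set ([::], y)] ([::], y) by apply: sub_closure.
by case: y h => // x; case: (closure_closed [set ([::], inl x)]) => _ c2 _ /c2.
Qed.

Lemma cgen_acc (y : label X) e : edge_closure [set ([::], y)] e ->
  edge_closure [set ([::], y)] ([::], inr (src e)).
Proof.
move: e; pose P v := edge_closure [set ([::], y)] ([::], inr v).
apply: (@closure_src _ _ P) => _ ->; rewrite /P /=.
by case: (closure_closed [set ([::], y)]) => c1 _ _; apply: c1 (@cgen_vert y).
Qed.

Definition cgen (y : label X) : cpair :=
  CPair (@closure_closed _ _) (@cgen_acc y) (@cgen_vert y).

Definition cmax (a : cbase) : cbase := cgen (inr (cend a)).

(** The class of [a] consists of all pairs with the same end $s$; each of them
    contains the barred edge from $\lambda$ to $s$, hence its closure. *)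
Lemma cmaxP (a : cbase) : is_class_max a (cmax a).
Proof.
split=> [|b /csigmaP eab]; first exact/csigmaP.
apply: cnleP => //; rewrite /cmax eab.
apply: closure_least; first exact: cclosed.
by move=> _ ->; apply: cvert.
Qed.

Definition clam : cbase := cgen (inr [::]).

Lemma clamP : is_max_proj clam.
Proof.
split; first by exists clam; apply: cpair_eq.
move=> e /proj_cend e0; have := (cmaxP e).2 e (sigma_refl e).
by rewrite /cmax e0.
Qed.

Definition cmodel : fRestr := FRestr cmaxP clamP.

Definition cvar (x : X) : cmodel := cgen (inl x).

Lemma cend_word_val u : cend (word_val cvar u) = u.
Proof.
case: u => [//|x u] /=.
suff gen (a : cmodel) : cend (foldl (fun a y => a * cvar y) a u) = cend a ++ u.
  by rewrite gen.
by elim: u a => [|y u IH] a /=; rewrite ?cats0 // IH /= -catA.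
Qed.

(** By induction on generation by the edges: a canonical morphism to the model
    can only be $(A, s) \mapsto (\langle A\rangle, s)$. *)
Lemma model_image (psi : M X -> cmodel) (p : M X) : is_canonical cvar psi ->
  cend (psi p) = mend p /\ cset (psi p) = edge_closure (edges (mgraph p)).
Proof.
move=> [[pm pp] px pu].
elim: (all_generated p) => [[x|u]|a b _ [ea sa] _ [eb sb]|a _ [ea sa]].
- by rewrite px.
- by rewrite pu /= /cmax cend_word_val.
- by rewrite pm /= ea eb sa sb closure_setU_shift.
- by rewrite pp.
Qed.

End Model.

Theorem proposition4p7 (X : Type) (hX : inhabited X)
    (A B : fagraph X) (s t : seq X) (hs : verts A s) (ht : verts B t) :
  rho (MPair hs : M X) (MPair ht : M X) <-> s = t /\ wedge A = wedge B.
Proof.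
split=> [r|[est eAB]]; last by apply: (canonical_wedge (FFR_morphP X)).
have [h [[hh hx] _]] := FFR_free (@cvar X).
(* the free object maps to the model compatibly with the two canonical
   morphisms, so equal images there stay equal in the model *)
have psiP := canonical_comp hh (FFR_morphP X).
rewrite (_ : (fun y => _) = @cvar X) in psiP; last exact/funext.
have [es eA] := model_image (MPair hs) psiP.
have [et eB] := model_image (MPair ht) psiP.
rewrite r in es eA; split; first by rewrite -[s]es.
by apply/wedge_eqP; rewrite -[LHS]eA -[RHS]eB.
Qed.
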